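(* Let $\mathrm S^n_+$ be the set of real $n\times n$ symmetric positive semi-definite matrices. The space $(\mathrm S^n_+\times\mathrm S^n_+,\operatorname{BW}^2)$, where $\operatorname{BW}$ is the Bures--Wasserstein metric, satisfies condition (NNCC-conv) and is thus an NNCC space.
   Context: The squared Bures--Wasserstein metric is $\operatorname{BW}^2(S_1,S_2)=\operatorname{tr}(S_1)+\operatorname{tr}(S_2)-2\operatorname{tr}\Big(\sqrt{S_1^{1/2}S_2S_1^{1/2}}\Big)$, where $S^{1/2}=\sqrt S$ denotes the unique positive semi-definite square root of a positive semi-definite matrix $S$. Condition (NNCC-conv) for a finite cost $c\colon X\times Y\to\mathbb R$: for any $x_0,x_1\in X$ and $\bar y\in Y$ there exists a path $\mathrm x\colon[0,1]\to X$ (an arbitrary function) with $\mathrm x(0)=x_0$, $\mathrm x(1)=x_1$ such that for every $y\in Y$ the function $s\mapsto c(\mathrm x(s),\bar y)-c(\mathrm x(s),y)$ is convex on $[0,1]$. $(X\times Y,c)$ is an NNCC space if for any $x_0,x_1\in X$, $\bar y\in Y$ there is a path $\mathrm x\colon[0,1]\to X$ with $\mathrm x(0)=x_0$, $\mathrm x(1)=x_1$ such that for all $s\in(0,1)$ and $y\in Y$, $c(\mathrm x(s),\bar y)-c(\mathrm x(s),y)\le(1-s)[c(x_0,\bar y)-c(x_0,y)]+s[c(x_1,\bar y)-c(x_1,y)]$. *)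

(* Defs.v *)
From mathcomp Require Import all_boot all_order all_algebra.
From mathcomp Require Import all_classical all_reals all_analysis.

Set Implicit Arguments.
Unset Strict Implicit.
Unset Printing Implicit Defensive.

Import Order.TTheory GRing.Theory Num.Theory.
Import numFieldNormedType.Exports.

Local Open Scope classical_set_scope.
Local Open Scope ring_scope.

Definition psdmx (R : realType) (n : nat) : set 'M[R]_n :=
  [set S | S \is symmetricmx /\
           forall v : 'cV[R]_n, 0 <= (v^T *m S *m v) 0 0].
Arguments psdmx : clear implicits.

(* The square root is the unique positive semi-definite T with T *m T = S; the
   default value 0 is only returned when there is none, which does not happen
   for S positive semi-definite. *)
Definition sqrtmx (R : realType) (n : nat) (S : 'M[R]_n) : 'M[R]_n :=
  xget 0 [set T | psdmx R n T /\ T *m T = S].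

Definition BW2 (R : realType) (n : nat) (S1 S2 : psdmx R n) : R :=
  \tr (val S1) + \tr (val S2)
  - 2 * \tr (sqrtmx (sqrtmx (val S1) *m val S2 *m sqrtmx (val S1))).

(* In the next two definitions a path [0, 1] -> X, which need not be regular in
   any way, is a function R -> X whose values outside [0, 1] are irrelevant. *)
Definition NNCC_conv (R : realType) (X Y : Type) (c : X -> Y -> R) : Prop :=
  forall (x0 x1 : X) (ybar : Y),
  exists x : R -> X,
    [/\ x 0 = x0, x 1 = x1 &
        forall y : Y,
          convex_function (`[0, 1] : set R^o)
            (fun s : R^o => c (x s) ybar - c (x s) y)].

Definition NNCC (R : realType) (X Y : Type) (c : X -> Y -> R) : Prop :=
  forall (x0 x1 : X) (ybar : Y),
  exists x : R -> X,
    [/\ x 0 = x0, x 1 = x1 &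
        forall (s : R) (y : Y), 0 < s < 1 ->
          c (x s) ybar - c (x s) y
            <= (1 - s) * (c x0 ybar - c x0 y) + s * (c x1 ybar - c x1 y)].

(* Main.v *)
Require Import Defs.
From mathcomp Require Import all_boot all_order all_algebra.
From mathcomp Require Import all_classical all_reals all_analysis.
From mathcomp Require Import ring lra.

(** Write F(S, T) for the trace of the square root of S^(1/2) T S^(1/2), so
that BW^2(S, T) = tr S + tr T - 2 F(S, T).  The proof rests on the variational
formula: whenever S = A A^T and T = B B^T,

  F(S, T) = max over orthogonal U of tr (A^T B U),

and the maximum is tr (A^T B) as soon as A^T B is positive semi-definite
([fidelity_ge], [fidelity_attained], [fidelity_psd]).

Given x0, x1 and ybar, put b = ybar^(1/2) and choose factors x0 = A0 A0^T and
x1 = A1 A1^T aligned with b, meaning that A0^T b and A1^T b are positive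
semi-definite ([psd_aligned]).  The path is x(s) = A(s) A(s)^T where A(s) is the
segment from A0 to A1; this is the projection of a segment of the flat space of
factors.  In the difference BW^2(x(s), ybar) - BW^2(x(s), y) the traces of x(s)
cancel, and up to a constant there remains 2 F(x(s), y) - 2 F(x(s), ybar).  The
second term is affine in s, because A(s)^T b stays positive semi-definite and
hence F(x(s), ybar) = tr (A(s)^T b).  The first one is convex in s, being a
maximum of affine functions of A(s) ([convex_fidelity]).

The variational formula comes from the polar decomposition, in the form: every
square M has an orthogonal U with M U positive semi-definite ([polar]).  Such a
U is a maximizer of tr (M U) on the compact orthogonal group; comparing it with
reflections, and with products of two of them, shows that M U is positive
semi-definite ([tr_max_psd]).  Applied to a Cholesky factor, the same
decomposition gives the existence of square roots ([sqrtmxP]); their uniqueness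
([psd_sqrt_unique]) identifies the factor M U with the square root of M M^T. *)

Set Implicit Arguments.
Unset Strict Implicit.
Unset Printing Implicit Defensive.

Import Order.TTheory GRing.Theory Num.Theory.
Import numFieldNormedType.Exports.

Local Open Scope classical_set_scope.
Local Open Scope ring_scope.

Section BuresWasserstein.
Variable R : realType.

(** * Positive semi-definite matrices *)

Definition bform n (S : 'M[R]_n) (x y : 'cV[R]_n) : R := (x^T *m S *m y) 0 0.

Lemma symmetricmxP n (S : 'M[R]_n) : (S \is symmetricmx) <-> S^T = S.
Proof.
rewrite qualifE /= expr0 scale1r map_mx_id //.
by split=> [/eqP <-|->].
Qed.

Lemma psdmxP n (S : 'M[R]_n) :
  psdmx R n S <-> S^T = S /\ forall v, 0 <= bform S v v.
Proof. by split=> -[/symmetricmxP hS pS]; split => //; apply/symmetricmxP. Qed.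

Lemma bform_delta n (S : 'M[R]_n) i j :
  bform S (delta_mx i 0) (delta_mx j 0) = S i j.
Proof. by rewrite /bform trmx_delta -rowE -colE !mxE. Qed.

Lemma bformDZ n (S : 'M[R]_n) x y a :
  bform S (x + a *: y) (x + a *: y) =
  bform S x x + a * bform S x y + a * bform S y x + a ^+ 2 * bform S y y.
Proof.
rewrite /bform; have -> : (x + a *: y)^T = x^T + a *: y^T.
  by apply/matrixP=> i j; rewrite !mxE.
rewrite !(mulmxDl, mulmxDr) -!(scalemxAl, scalemxAr).
by rewrite !mxE; ring.
Qed.

Lemma bform_sym n (S : 'M[R]_n) x y : S^T = S -> bform S x y = bform S y x.
Proof.
move=> hS; rewrite /bform.
have -> : y^T *m S *m x = (x^T *m S *m y)^T.
  by rewrite !trmx_mul trmxK hS mulmxA.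
by rewrite [RHS]mxE.
Qed.

Lemma psd_sym n (S : 'M[R]_n) : psdmx R n S -> S^T = S.
Proof. by case/psdmxP. Qed.

Lemma psd_bform_ge0 n (S : 'M[R]_n) v : psdmx R n S -> 0 <= bform S v v.
Proof. by case/psdmxP. Qed.

Lemma psd_diag_ge0 n (S : 'M[R]_n) i : psdmx R n S -> 0 <= S i i.
Proof. by rewrite -bform_delta; exact: psd_bform_ge0. Qed.

Lemma psd_congr m n (S : 'M[R]_n) (A : 'M[R]_(n, m)) :
  psdmx R n S -> psdmx R m (A^T *m S *m A).
Proof.
move=> /psdmxP[hS pS]; apply/psdmxP; split.
  by rewrite !trmx_mul trmxK hS mulmxA.
move=> v; have := pS (A *m v); rewrite /bform trmx_mul.
by rewrite !mulmxA.
Qed.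

Lemma psd1 n : psdmx R n 1%:M.
Proof.
apply/psdmxP; split=> [|v]; first exact: trmx1.
rewrite /bform mulmx1 mxE; apply: sumr_ge0 => i _.
by rewrite mxE -expr2 sqr_ge0.
Qed.

Lemma psd_gram m n (A : 'M[R]_(n, m)) : psdmx R n (A *m A^T).
Proof. by have := psd_congr A^T (psd1 m); rewrite trmxK mulmx1. Qed.

Lemma psd_tr_ge0 n (S : 'M[R]_n) : psdmx R n S -> 0 <= \tr S.
Proof. by move=> pS; apply: sumr_ge0 => i _; exact: psd_diag_ge0. Qed.

Lemma affine_ge0 (a b : R) : (forall t, 0 <= t * a + b) -> a = 0.
Proof.
move=> h; apply/eqP; apply: contraT => a0; have := h (- (b + 1) / a).
by rewrite mulrVK ?unitfE//; lra.
Qed.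

(** The quadratic form at t e_i + e_j is affine in t when S i i = 0, so its
slope 2 S i j vanishes. *)
Lemma psd_diag0 n (S : 'M[R]_n) i j : psdmx R n S -> S i i = 0 -> S i j = 0.
Proof.
move=> pS Sii; apply: (@mulIf _ 2); rewrite ?mul0r //.
apply: (@affine_ge0 _ (S j j)) => t.
have := psd_bform_ge0 (delta_mx j 0 + t *: delta_mx i 0) pS.
rewrite bformDZ [bform S (delta_mx j 0) (delta_mx i 0)]bform_sym ?psd_sym//.
by rewrite !bform_delta Sii; lra.
Qed.

Lemma psd_tr0 n (S : 'M[R]_n) : psdmx R n S -> \tr S = 0 -> S = 0.
Proof.
move=> pS /eqP; rewrite psumr_eq0 => [/allP S0|i _]; last exact: psd_diag_ge0.
apply/matrixP => i j; rewrite mxE psd_diag0 //.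
by apply/eqP/S0; rewrite mem_index_enum.
Qed.

Lemma gram0 m n (A : 'M[R]_(n, m)) : A *m A^T = 0 -> A = 0.
Proof.
move=> A0; apply/matrixP => i j; rewrite mxE.
have /matrixP/(_ i i) := A0; rewrite !mxE => /eqP.
rewrite psumr_eq0 => [/allP h|k _]; last by rewrite mxE -expr2 sqr_ge0.
have := h j; rewrite mem_index_enum mxE mulf_eq0 orbb => /(_ isT).
by move/eqP.
Qed.

(** One step of symmetric Gaussian elimination: the form of the Schur complement
at v is the form of S at v shifted along e_k by the minimizing amount. *)
Lemma psd_schur n (S : 'M[R]_n) k : psdmx R n S -> S k k != 0 ->
  psdmx R n (S - (S k k)^-1 *: (col k S *m (col k S)^T)).
Proof.
move=> pS Sk; have hS := psd_sym pS; apply/psdmxP; split.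
  rewrite linearB linearZ /= hS; congr (_ - _ *: _).
  by rewrite trmx_mul trmxK.
move=> v; pose b := bform S v (delta_mx k 0).
have := psd_bform_ge0 (v + (- (S k k)^-1 * b) *: delta_mx k 0) pS.
rewrite bformDZ [bform S (delta_mx k 0) v]bform_sym // -/b bform_delta.
suff -> : bform (S - (S k k)^-1 *: (col k S *m (col k S)^T)) v v =
  bform S v v - (S k k)^-1 * (b * b).
  suff -> : bform S v v + - (S k k)^-1 * b * b + - (S k k)^-1 * b * b +
    (- (S k k)^-1 * b) ^+ 2 * S k k = bform S v v - (S k k)^-1 * (b * b) by [].
  by field.
have hb : v^T *m col k S = b%:M.
  by rewrite colE mulmxA /b /bform [LHS]mx11_scalar.
rewrite /bform mulmxBr mulmxBl -scalemxAr -scalemxAl !mulmxA hb.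
rewrite -(mulmxA b%:M) -[(col k S)^T *m v]trmxK trmx_mul trmxK hb tr_scalar_mx.
by rewrite -scalar_mxM !mxE mulr1n.
Qed.

(** Elimination of one nonzero diagonal entry splits off a rank-one term w w^T
and creates no new nonzero diagonal entry, so at most n columns are needed. *)
Lemma psd_cholesky n (S : 'M[R]_n) : psdmx R n S ->
  exists B : 'M[R]_n, S = B *m B^T.
Proof.
suff H m (T : 'M[R]_n) : psdmx R n T ->
    (#|[set i | (T i i != 0)%R]%SET| <= m)%N ->
  exists B : 'M[R]_(n, m), T = B *m B^T.
  by move=> pS; apply: H => //; rewrite (leq_trans (max_card _)) ?card_ord.
elim: m T => [|m IH] T pT.
  rewrite leqn0 cards_eq0 => /eqP T0; exists 0; rewrite mul0mx.
  apply: psd_tr0 => //.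
  apply: big1 => i _; apply/eqP; have /setP/(_ i) := T0.
  by rewrite !inE => /negbFE.
case: (pickP (fun i => T i i != 0)) => [k Tk|T0] hT; last first.
  exists 0; rewrite mul0mx; apply: psd_tr0 => //.
  by apply: big1 => i _; apply/eqP; have := T0 i => /negbFE.
have [|B hB] := IH _ (psd_schur pT Tk).
  have : [set i | (T - (T k k)^-1 *: (col k T *m (col k T)^T)) i i != 0]%SET
     \subset [set i | T i i != 0]%SET :\ k.
    apply/fintype.subsetP => i; rewrite !inE !mxE big_ord1 !mxE => h.
    apply/andP; split; apply: contra h => /eqP Ti.
      by rewrite Ti mulKf // subrr.
    by rewrite (psd_diag0 k pT Ti) Ti mul0r mulr0 subrr.
  move=> /subset_leq_card /leq_trans -> //.
  by rewrite -ltnS (leq_trans _ hT) // [leqRHS](cardsD1 k) inE Tk.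
pose w := (Num.sqrt (T k k))^-1 *: col k T.
exists (row_mx w B); transitivity (w *m w^T + B *m B^T); last first.
  by rewrite -mul_row_col -tr_row_mx.
rewrite -hB linearZ /= -scalemxAl -scalemxAr scalerA.
rewrite -invfM -expr2 sqr_sqrtr ?psd_diag_ge0 //.
by rewrite addrC subrK.
Qed.

(** With D = P - T, the hypothesis gives P D + D T = 0, hence
tr (D P D) + tr (D T D) = 0.  Both terms are traces of positive semi-definite
matrices, so D P D = D T D = 0; thus D^3 = 0, and D = 0 as D is symmetric. *)
Lemma psd_sqrt_unique n (P T : 'M[R]_n) :
  psdmx R n P -> psdmx R n T -> P *m P = T *m T -> P = T.
Proof.
move=> pP pT PT; pose D := P - T.
have hD : D^T = D by rewrite /D linearB /= !psd_sym.
have pDPD := psd_congr D pP; have pDTD := psd_congr D pT.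
have tr0 : \tr (D^T *m P *m D) + \tr (D^T *m T *m D) = 0.
  have : P *m D + D *m T = 0.
    by rewrite /D mulmxBr mulmxBl PT addrA subrK subrr.
  move=> /(congr1 (mulmx D)); rewrite mulmx0 mulmxDr => /(congr1 mxtrace).
  by rewrite mxtrace0 mxtraceD [\tr (D *m (D *m T))]mxtrace_mulC hD !mulmxA.
have [tP tT] : \tr (D^T *m P *m D) = 0 /\ \tr (D^T *m T *m D) = 0.
  have := psd_tr_ge0 pDPD; have := psd_tr_ge0 pDTD; lra.
have D3 : D *m D *m D = 0.
  transitivity (D^T *m P *m D - D^T *m T *m D).
    by rewrite hD -mulmxBl -mulmxBr.
  by rewrite (psd_tr0 pDPD tP) (psd_tr0 pDTD tT) subrr.
have D2 : D *m D = 0.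
  by apply: gram0; rewrite trmx_mul hD mulmxA D3 mul0mx.
have : D = 0 by apply: gram0; rewrite hD.
by move/eqP; rewrite subr_eq0 => /eqP.
Qed.

Definition orthmx n (U : 'M[R]_n) := U *m U^T = 1%:M.

Lemma orthmxV n (U : 'M[R]_n) : orthmx U -> U^T *m U = 1%:M.
Proof. exact: mulmx1C. Qed.

Lemma orthmx_tr n (U : 'M[R]_n) : orthmx U -> orthmx U^T.
Proof. by move=> hU; rewrite /orthmx trmxK orthmxV. Qed.

Lemma orthmxM n (U V : 'M[R]_n) : orthmx U -> orthmx V -> orthmx (U *m V).
Proof.
by move=> hU hV; rewrite /orthmx trmx_mul mulmxA -(mulmxA U) hV mulmx1.
Qed.

(** With K = B B^T, the gap is half the squared Frobenius norm of
B^T U - B^T. *)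
Lemma tr_psd_orth_le n (K U : 'M[R]_n) :
  psdmx R n K -> orthmx U -> \tr (K *m U) <= \tr K.
Proof.
move=> pK hU; have [B hB] := psd_cholesky pK.
have := psd_tr_ge0 (psd_gram (B^T *m U - B^T)).
rewrite linearB /= trmx_mul trmxK mulmxBl !mulmxBr !linearB /=.
rewrite mulmxA -(mulmxA B^T U) hU mulmx1.
have -> : \tr (B^T *m B) = \tr K by rewrite hB mxtrace_mulC.
have -> : \tr (B^T *m U *m B) = \tr (K *m U).
  by rewrite mxtrace_mulC mulmxA -hB.
have -> : \tr (B^T *m (U^T *m B)) = \tr (K *m U).
  rewrite -[LHS]mxtrace_tr !trmx_mul !trmxK -[LHS]mxtrace_mulC.
  by rewrite mulmxA -hB.
lra.
Qed.

(** * The orthogonal group and the polar decomposition *)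

Lemma vec_mx_coord_continuous n i j :
  continuous (fun v : 'rV[R]_(n * n) => vec_mx v i j).
Proof.
have -> : (fun v : 'rV[R]_(n * n) => vec_mx v i j) =
          (fun v => v 0 (mxvec_index i j)) by apply/funext => v; rewrite mxE.
exact: coord_continuous.
Qed.

Lemma orthmx_entry_le1 n (U : 'M[R]_n) i j : orthmx U -> -1 <= U i j <= 1.
Proof.
move=> /matrixP/(_ i i); rewrite !mxE eqxx (bigD1 j) //= mxE => Uij.
rewrite -ler_norml -(ler_pXn2r (n := 2)) ?nnegrE // real_normK ?num_real //.
rewrite expr1n.
rewrite -[leRHS]Uij -expr2 lerDl; apply: sumr_ge0 => k _.
by rewrite mxE -expr2 sqr_ge0.
Qed.

(** The orthogonal group, flattened to row vectors, is closed in a cube: it is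
cut out by polynomial equations and the entries of its elements are at most 1
in absolute value. *)
Lemma orthmx_compact n : compact [set v : 'rV[R]_(n * n) | orthmx (vec_mx v)].
Proof.
have cube_compact :
    compact [set v : 'rV[R]_(n * n) | forall i, `[-1, 1]%classic (v ord0 i)].
  apply: (@rV_compact R _ (fun=> `[-1, 1]%classic)) => _.
  exact: segment_compact.
apply: subclosed_compact _ cube_compact _.
  have -> : [set v : 'rV[R]_(n * n) | orthmx (vec_mx v)] =
    \bigcap_(ij in [set: 'I_n * 'I_n])
      (fun v => \sum_k vec_mx v ij.1 k * vec_mx v ij.2 k) @^-1`
        [set x | x = (ij.1 == ij.2)%:R].
    apply/seteqP; split=> v /=.
      move=> hv [i j] _ /=; have /matrixP/(_ i j) := hv; rewrite !mxE => <-.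
      by apply: eq_bigr => k _; rewrite !mxE.
    move=> hv; apply/matrixP => i j; have /= hij := hv (i, j) I.
    rewrite !mxE -hij.
    by apply: eq_bigr => k _; rewrite !mxE.
  apply: closed_bigI => -[i j] _; apply: preimage_closed; last exact: closed_eq.
  move=> v _; apply: continuous_big; first exact: add_continuous.
  by move=> k _ {}v; apply: continuousM; exact: vec_mx_coord_continuous.
move=> v hv i /=; rewrite in_itv /= -[v]vec_mxK.
by case/mxvec_indexP: i => i j; rewrite mxvecE; exact: orthmx_entry_le1.
Qed.

Lemma orthmx_tr_max n (M : 'M[R]_n) :
  exists2 U, orthmx U & forall V, orthmx V -> \tr (M *m V) <= \tr (M *m U).
Proof.
have [||u] :=
  EVT_max_rV (f := fun v => \tr (M *m vec_mx v)) _ (@orthmx_compact n).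
- by exists (mxvec 1%:M); rewrite /= mxvecK /orthmx trmx1 mulmx1.
- apply: continuous_subspaceT; apply: continuous_big => //.
    exact: add_continuous.
  move=> i _.
  have -> : (fun v : 'rV[R]_(n * n) => (M *m vec_mx v) i i) =
            (fun v => \sum_k M i k * vec_mx v k i).
    by apply/funext => v; rewrite mxE.
  apply: continuous_big; first exact: add_continuous.
  move=> k _ v; apply: continuousM; first exact: cst_continuous.
  exact: vec_mx_coord_continuous.
rewrite inE => hu umax; exists (vec_mx u) => // V hV.
by have := umax (mxvec V); rewrite mxvecK; apply; rewrite inE /= mxvecK.
Qed.

Definition householder n (q : 'cV[R]_n) : 'M[R]_n :=
  1%:M - (2 / bform 1%:M q q) *: (q *m q^T).

Lemma dotE n (x y : 'cV[R]_n) : x^T *m y = (bform 1%:M x y)%:M.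
Proof. by rewrite /bform mulmx1 [LHS]mx11_scalar. Qed.

Lemma householder_orth n (q : 'cV[R]_n) :
  bform 1%:M q q != 0 -> orthmx (householder q).
Proof.
move=> q0; have hT : (householder q)^T = householder q.
  by rewrite /householder linearB linearZ /= trmx1 trmx_mul trmxK.
rewrite /orthmx hT /householder.
rewrite mulmxBl mul1mx mulmxBr mulmx1 -!scalemxAl -!scalemxAr.
rewrite -mulmxA [q^T *m _]mulmxA dotE mul_scalar_mx -scalemxAr !scalerA.
rewrite -addrA -opprD; apply/eqP; rewrite subr_eq addrC -subr_eq subrr eq_sym.
rewrite -scalerBl -scalerDl scaler_eq0; apply/orP; left; apply/eqP.
by field.
Qed.

Lemma tr_rank1 n (P : 'M[R]_n) x y : \tr (P *m (x *m y^T)) = bform P y x.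
Proof. by rewrite mulmxA mxtrace_mulC mulmxA /mxtrace big_ord1. Qed.

(** First-order optimality of the identity.  The reflection along q lowers the
trace of P by a positive multiple of q^T P q, which is therefore nonnegative.
The product of the reflections along e_i and e_i + t e_j is a rotation in the
plane of e_i and e_j whose angle vanishes with t; its optimality condition is
t (P j i - P i j) <= t^2 (P i i + P j j), which for small t of either sign
forces P j i = P i j. *)
Lemma tr_max_psd n (P : 'M[R]_n) :
  (forall V, orthmx V -> \tr (P *m V) <= \tr P) -> psdmx R n P.
Proof.
move=> Pmax.
have bP q : 0 <= bform P q q.
  have := psd_bform_ge0 q (psd1 n); rewrite le_eqVlt => /predU1P[q0|q0].
    (* There is no reflection along q = 0, where the form vanishes anyway. *)
    have /gram0 : q^T *m q^T^T = 0 by rewrite trmxK dotE -q0 raddf0.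
    move=> /(congr1 trmx); rewrite trmxK trmx0 => ->.
    by rewrite /bform mulmx0 mxE.
  have := Pmax _ (householder_orth (lt0r_neq0 q0)).
  rewrite /householder mulmxBr mulmx1 linearB -scalemxAr linearZ /= tr_rank1.
  rewrite gerBl pmulr_rge0 // divr_gt0 //.
apply/psdmxP; split => //; apply/matrixP => i j; rewrite mxE.
have [-> //|ij] := eqVneq i j.
pose p : 'cV[R]_n := delta_mx i 0.
pose q t : 'cV[R]_n := p + t *: delta_mx j 0.
have pp : bform 1%:M p p = 1 by rewrite bform_delta mxE eqxx.
have qq t : bform 1%:M (q t) (q t) = 1 + t ^+ 2.
  rewrite bformDZ !bform_delta !mxE !eqxx [j == i]eq_sym (negbTE ij) /=.
  by ring.
have pq t : bform 1%:M p (q t) = 1.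
  rewrite /bform mulmxDr -scalemxAr mxE [X in X + _]pp mxE.
  by rewrite [X in _ * X]bform_delta mxE (negbTE ij) mulr0 addr0.
have key t : t * (P j i - P i j) <= t ^+ 2 * (P i i + P j j).
  have t1 : 1 + t ^+ 2 != 0 by rewrite gt_eqF // ltr_pwDl // sqr_ge0.
  have := Pmax _ (orthmxM (householder_orth (q := p) _)
                          (householder_orth (q := q t) _)).
  rewrite pp qq oner_eq0 => /(_ isT t1).
  pose b := 2 / (1 + t ^+ 2).
  have -> : householder p *m householder (q t) = 1%:M + (- 2) *: (p *m p^T)
      + (- b) *: (q t *m (q t)^T) + (2 * b) *: (p *m (q t)^T).
    rewrite !scaleNr /householder pp qq -/b divr1 mulmxBl mul1mx mulmxBr mulmx1.
    rewrite -!scalemxAl -!scalemxAr scalerA -mulmxA [p^T *m _]mulmxA.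
    rewrite dotE pq mul1mx.
    by rewrite opprB addrA [LHS]addrAC -!addrA; congr (_ + _); rewrite addrCA.
  have trZ (A B : 'M[R]_n) c :
      \tr (P *m (A + c *: B)) = \tr (P *m A) + c * \tr (P *m B).
    by rewrite mulmxDr -scalemxAr mxtraceD mxtraceZ.
  rewrite !trZ mulmx1 !tr_rank1.
  have -> : bform P (q t) p = P i i + t * P j i.
    rewrite /bform; have -> : (q t)^T = p^T + t *: (delta_mx j 0)^T.
      by apply/matrixP => x y; rewrite !mxE.
    rewrite !mulmxDl -!scalemxAl mxE [X in _ + X]mxE -!/(bform _ _ _).
    by rewrite !bform_delta.
  rewrite bformDZ !bform_delta => h.
  pose Y := P i i + t * P j i - t * P i j - t ^+ 2 * P j j.
  have {h} : (1 + t ^+ 2) * (- 2 * P i i + b * Y) <= 0.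
    by rewrite pmulr_rle0 ?ltr_pwDl ?sqr_ge0 //; move: h; rewrite /Y; lra.
  rewrite mulrDr mulrA [_ * (b * Y)]mulrCA mulrA divfK // /Y; lra.
(* For a difference d and a sum s, the condition at t = d / (1 + s) reads
   d^2 (1 + s) <= d^2 s. *)
have := key ((P j i - P i j) / (1 + (P i i + P j j))).
have s_gt0 : 0 < 1 + (P i i + P j j).
  by rewrite ltr_pwDl // addr_ge0 // -bform_delta.
move: (P j i - P i j) (P i i + P j j) s_gt0 (subr_eq0 (P j i) (P i j)).
move=> d s s1 ds h.
apply/eqP; rewrite -ds -sqrf_eq0 eq_le sqr_ge0 andbT.
have : (1 + s) ^+ 2 * (d / (1 + s) * d) <=
    (1 + s) ^+ 2 * ((d / (1 + s)) ^+ 2 * s).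
  by rewrite ler_wpM2l // sqr_ge0.
have -> : (1 + s) ^+ 2 * (d / (1 + s) * d) = d ^+ 2 * (1 + s).
  by field; rewrite gt_eqF.
have -> : (1 + s) ^+ 2 * ((d / (1 + s)) ^+ 2 * s) = d ^+ 2 * s.
  by field; rewrite gt_eqF.
lra.
Qed.

Lemma polar n (M : 'M[R]_n) : exists2 U, orthmx U & psdmx R n (M *m U).
Proof.
have [U hU Umax] := orthmx_tr_max M; exists U => //.
by apply: tr_max_psd => V hV; rewrite -mulmxA; apply/Umax/orthmxM.
Qed.

(** The polar decomposition with its positive factor on the left and prescribed:
any square root of M M^T will do, by uniqueness. *)
Lemma gram_polar n (M T : 'M[R]_n) : psdmx R n T -> T *m T = M *m M^T ->
  exists2 U, orthmx U & M = T *m U.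
Proof.
move=> pT TT; have [V hV pMV] := polar M; exists V^T; first exact: orthmx_tr.
suff <- : M *m V = T by rewrite -mulmxA hV mulmx1.
apply: psd_sqrt_unique => //; rewrite -[X in _ *m X](psd_sym pMV) TT.
by rewrite trmx_mul mulmxA -(mulmxA M V) hV mulmx1.
Qed.

(** A Cholesky factor B multiplied by the U of its polar decomposition is
positive semi-definite, with the same Gram matrix B B^T. *)
Lemma sqrtmxP n (S : 'M[R]_n) : psdmx R n S ->
  psdmx R n (sqrtmx S) /\ sqrtmx S *m sqrtmx S = S.
Proof.
move=> /psd_cholesky[B hB]; have [U hU pBU] := polar B.
apply: (@xgetPex _ 0 [set T | psdmx R n T /\ T *m T = S]).
exists (B *m U); split => //; rewrite -[X in _ *m X](psd_sym pBU).
by rewrite trmx_mul mulmxA -(mulmxA B U) hU mulmx1 hB.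
Qed.

(** * The variational formula for the fidelity *)

Definition fidelity n (S T : 'M[R]_n) : R :=
  \tr (sqrtmx (sqrtmx S *m T *m sqrtmx S)).

(** Writing A = a V and B = b W with a, b the square roots of the Gram matrices
and V, W orthogonal, A^T B = V^T (a b) W, while K = sqrt (a b b a) is the
positive factor of a b.  So A^T B is K between two orthogonal matrices. *)
Lemma fidelity_polar n (A B : 'M[R]_n) :
  exists K U : 'M[R]_n, [/\ psdmx R n K, orthmx U,
    fidelity (A *m A^T) (B *m B^T) = \tr K &
    exists2 V, orthmx V & A^T *m B = V^T *m K *m U].
Proof.
have [pa aa] := sqrtmxP (psd_gram A); have [pb bb] := sqrtmxP (psd_gram B).
rewrite /fidelity.
move: (sqrtmx (A *m A^T)) (sqrtmx (B *m B^T)) pa aa pb bb => a b pa aa pb bb.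
have [V hV ->] := gram_polar pa aa; have [W hW hB] := gram_polar pb bb.
have eK : a *m (B *m B^T) *m a = (a *m b) *m (a *m b)^T.
  by rewrite -bb trmx_mul (psd_sym pa) (psd_sym pb) !mulmxA.
have [pK KK] := sqrtmxP (psd_gram (a *m b)).
have [Z hZ eab] := gram_polar pK KK.
rewrite eK; move: (sqrtmx _) pK KK eab => K pK _ eab.
exists K, (Z *m W); split => //; first exact: orthmxM.
exists V => //; rewrite hB trmx_mul (psd_sym pa) mulmxA -(mulmxA _ a b) eab.
by rewrite !mulmxA.
Qed.

Lemma fidelity_ge n (A B U : 'M[R]_n) : orthmx U ->
  \tr (A^T *m B *m U) <= fidelity (A *m A^T) (B *m B^T).
Proof.
move=> hU; have [K [Z [pK hZ -> [V hV ->]]]] := fidelity_polar A B.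
rewrite -!mulmxA mxtrace_mulC -!mulmxA; apply: tr_psd_orth_le => //.
by apply: orthmxM => //; apply: orthmxM => //; exact: orthmx_tr.
Qed.

Lemma fidelity_attained n (A B : 'M[R]_n) : exists2 U, orthmx U &
  fidelity (A *m A^T) (B *m B^T) = \tr (A^T *m B *m U).
Proof.
have [K [Z [pK hZ -> [V hV ->]]]] := fidelity_polar A B.
exists (Z^T *m V); first by apply: orthmxM => //; exact: orthmx_tr.
rewrite mulmxA -(mulmxA _ Z) hZ mulmx1 -mulmxA mxtrace_mulC -mulmxA hV.
by rewrite mulmx1.
Qed.

(** A positive semi-definite A^T B is its own positive factor, so the identity
is optimal by [tr_psd_orth_le]. *)
Lemma fidelity_psd n (A B : 'M[R]_n) : psdmx R n (A^T *m B) ->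
  fidelity (A *m A^T) (B *m B^T) = \tr (A^T *m B).
Proof.
move=> pAB; apply/eqP; rewrite eq_le; apply/andP; split.
  by have [U hU ->] := fidelity_attained A B; exact: tr_psd_orth_le.
have := @fidelity_ge _ A B 1%:M; rewrite mulmx1; apply.
by rewrite /orthmx trmx1 mulmx1.
Qed.

(** * Convexity along aligned segments *)

(** For the U attaining F at A, the trace of A^T B U is affine in A, and at the
endpoints it is bounded by the maximum. *)
Lemma convex_fidelity n (A A0 A1 B : 'M[R]_n) (s : R) : 0 <= s <= 1 ->
  A = (1 - s) *: A0 + s *: A1 ->
  fidelity (A *m A^T) (B *m B^T) <=
    (1 - s) * fidelity (A0 *m A0^T) (B *m B^T)
    + s * fidelity (A1 *m A1^T) (B *m B^T).
Proof.
move=> /andP[s0 s1] AE; have [U hU ->] := fidelity_attained A B.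
have -> : A^T *m B *m U = (1 - s) *: (A0^T *m B *m U) + s *: (A1^T *m B *m U).
  have -> : A^T = (1 - s) *: A0^T + s *: A1^T.
    by apply/matrixP => i j; rewrite AE !mxE.
  by rewrite !mulmxDl -!scalemxAl.
by rewrite mxtraceD !mxtraceZ lerD // ler_wpM2l ?subr_ge0 // fidelity_ge.
Qed.

(** The polar decomposition of T^(1/2) S^(1/2) gives an optimal factor of S:
replacing S^(1/2) by A = S^(1/2) U makes A^T T^(1/2) positive semi-definite. *)
Lemma psd_aligned n (S T : 'M[R]_n) : psdmx R n S -> psdmx R n T ->
  exists2 A, A *m A^T = S & psdmx R n (A^T *m sqrtmx T).
Proof.
move=> /sqrtmxP[pa aa] /sqrtmxP[pb _].
have [U hU pU] := polar (sqrtmx T *m sqrtmx S); exists (sqrtmx S *m U).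
  by rewrite trmx_mul mulmxA -(mulmxA _ U) hU mulmx1 (psd_sym pa).
have := pU; rewrite -(psd_sym pU) !trmx_mul (psd_sym pa) (psd_sym pb).
by rewrite mulmxA.
Qed.

Lemma psd_conv n (S T : 'M[R]_n) (s : R) : 0 <= s <= 1 ->
  psdmx R n S -> psdmx R n T -> psdmx R n ((1 - s) *: S + s *: T).
Proof.
move=> /andP[s0 s1] /psdmxP[hS pS] /psdmxP[hT pT]; apply/psdmxP; split.
  by rewrite linearD !linearZ /= hS hT.
move=> v; rewrite /bform mulmxDr mulmxDl -!scalemxAr -!scalemxAl.
rewrite !mxE; apply: addr_ge0; apply: mulr_ge0; rewrite ?subr_ge0 //.
  by have := pS v; rewrite /bform mxE.
by have := pT v; rewrite /bform mxE.
Qed.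

Lemma BW2_NNCC_conv n : NNCC_conv (@BW2 R n).
Proof.
move=> x0 x1 ybar.
have [A0 h0 p0] := psd_aligned (set_valP x0) (set_valP ybar).
have [A1 h1 p1] := psd_aligned (set_valP x1) (set_valP ybar).
have [pb bb] := sqrtmxP (set_valP ybar).
set b := sqrtmx (val ybar) in p0 p1 pb bb.
have gram_b : val ybar = b *m b^T by rewrite psd_sym.
pose A (s : R) := (1 - s) *: A0 + s *: A1.
pose x s : psdmx R n := SigSub (mem_set (psd_gram (A s))).
have diffE s y : 0 <= s <= 1 -> BW2 (x s) ybar - BW2 (x s) y =
    \tr (val ybar) - \tr (val y) - 2 * \tr ((A s)^T *m b)
    + 2 * fidelity (A s *m (A s)^T) (val y).
  move=> s01; rewrite -fidelity_psd -?gram_b.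
    by rewrite /BW2 /fidelity; ring.
  have -> : (A s)^T *m b = (1 - s) *: (A0^T *m b) + s *: (A1^T *m b).
    have -> : (A s)^T = (1 - s) *: A0^T + s *: A1^T.
      by apply/matrixP => i j; rewrite !mxE.
    by rewrite mulmxDl -!scalemxAl.
  exact: psd_conv.
exists x; split.
- by apply: val_inj => /=; rewrite /A subr0 scale1r scale0r addr0.
- by apply: val_inj => /=; rewrite /A subrr scale1r scale0r add0r.
move=> y t u v; rewrite !inE /= !in_itv /= => u01 v01.
set w := conv t u v.
have [t0 t1] : 0 <= t%:num /\ t%:num <= 1 by split.
have wE : w = (1 - t%:num) * v + t%:num * u by rewrite addrC.
have AwE : A w = (1 - t%:num) *: A v + t%:num *: A u.
  by apply/matrixP => i j; rewrite wE !mxE; ring.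
have w01 : 0 <= w <= 1.
  by rewrite wE; move: u01 v01 => /andP[? ?] /andP[? ?]; nra.
rewrite convRE !diffE //.
have [py yy] := sqrtmxP (set_valP y).
have -> : val y = sqrtmx (val y) *m (sqrtmx (val y))^T by rewrite psd_sym.
have t01 : 0 <= t%:num <= 1 by rewrite t0.
have := convex_fidelity (sqrtmx (val y)) t01 AwE.
have -> : \tr ((A w)^T *m b) =
    (1 - t%:num) * \tr ((A v)^T *m b) + t%:num * \tr ((A u)^T *m b).
  have -> : (A w)^T = (1 - t%:num) *: (A v)^T + t%:num *: (A u)^T.
    by apply/matrixP => i j; rewrite AwE !mxE.
  by rewrite mulmxDl -!scalemxAl mxtraceD !mxtraceZ.
rewrite /unstable.onem; lra.
Qed.

(** Convexity on the segment is used between its two endpoints only. *)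
Lemma NNCC_conv_NNCC (X Y : Type) (c : X -> Y -> R) : NNCC_conv c -> NNCC c.
Proof.
move=> h x0 x1 ybar; have [x [x0E x1E xconv]] := h x0 x1 ybar.
exists x; split => // s y /andP[s0 s1].
have := xconv y (Itv01 (ltW s0) (ltW s1)) 1 0.
rewrite !inE /= !in_itv /= !lexx !ler01 => /(_ isT isT).
have -> : conv (Itv01 (ltW s0) (ltW s1)) (1 : convex_lmodType R^o) 0 = s.
  by rewrite -[RHS]mulr1 -[RHS]addr0 -[in RHS](mulr0 (1 - s)).
by rewrite convRE /= x0E x1E /unstable.onem [leRHS]addrC.
Qed.

End BuresWasserstein.

Theorem theorem4p10 (R : realType) (n : nat) :
  NNCC_conv (@BW2 R n) /\ NNCC (@BW2 R n).
Proof.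
by split; [|apply: NNCC_conv_NNCC]; exact: BW2_NNCC_conv.
Qed.
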